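(* Consider Lie algebras $\mathfrak g$ in $\mathrm{Ver}_4^+$ with underlying object $2\cdot\mathbf 1+P$ such that $[\mathfrak g,\ker d]\subset\ker d$ (i.e. $f=0$) and such that the ordinary Lie algebra $\ker d$ is isomorphic to the $3$-dimensional Lie algebra with basis $x,y,z$ whose only nonzero bracket is $[x,y]=z$. The isomorphism classes of such Lie algebras are the following, where $v,v'$ is a basis of $P$ with $v'=dv$, $x,y$ is a basis of $2\cdot\mathbf 1$, $\lambda,\mu\in k$ are parameters, each one has $[x,y]=v'$, and brackets among $x,y,v'$ other than $[x,y]=[y,x]$ vanish: 1.1. $[v,v]=0$, $[v,v']=0$, $[v,x]=0$, $[v,y]=\lambda x$; 1.2. $[v,v]=0$, $[v,v']=0$, $[v,x]=x$, $[v,y]=\lambda x+y$; 1.3. $[v,v]=0$, $[v,v']=v'$, $[v,x]=\lambda x$, $[v,y]=(\lambda+1)y$; 1.4. $[v,v]=v'$, $[v,v']=0$, $[v,x]=0$, $[v,y]=\lambda x$; 1.5. $[v,v]=\lambda v'$, $[v,v']=0$, $[v,x]=x$, $[v,y]=\mu x+y$. That is, each of these is such a Lie algebra, and every such Lie algebra is isomorphic to one in this list (different rows or parameter values are not asserted to be non-isomorphic).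
   Context: Let $k$ be an algebraically closed field of characteristic $2$. $\mathrm{Ver}_4^+$ is the symmetric tensor category whose objects are finite-dimensional $k$-vector spaces $V$ with a linear endomorphism $d$, $d^2=0$ (write $x'=dx$), morphisms are linear maps commuting with $d$, $d$ acts on tensor products by $d\otimes1+1\otimes d$, and the braiding is $c(v\otimes w)=w\otimes v+w'\otimes v'$. $\mathbf 1$ is the one-dimensional object with $d=0$; $P$ is the two-dimensional object $k[d]/d^2$. A Lie algebra in $\mathrm{Ver}_4^+$ is an object with a bilinear bracket $[\cdot,\cdot]$ satisfying $d[x,y]=[x',y]+[x,y']$; $[x,y]+[y,x]+[y',x']=0$; $[[x,y],z]+[[z,x],y]+[[y,z],x]+[[x',y],z']+[[z',x],y']+[[y',z],x']=0$; and $[x,x]=0$ whenever $x'=0$. (In particular $[x,y]=[y,x]$ if $y\in\ker d$, and $\ker d$ is an ordinary Lie algebra.) Isomorphisms are linear bijections commuting with $d$ and preserving the bracket. For a Lie algebra $\mathfrak g$ on $m\cdot\mathbf 1+P$ with $L=\ker d$, the quotient $\mathfrak g/L$ is a one-dimensional $L$-module; $f:L\to k$ denotes the corresponding character, i.e. $[v,w]\equiv f(w)v \pmod L$ for $v\in\mathfrak g$, $w\in L$. *)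

(* Defs.v *)
From HB Require Import structures.
From mathcomp Require Import all_boot all_order all_algebra ring.

Set Implicit Arguments.
Unset Strict Implicit.
Unset Printing Implicit Defensive.

Import GRing.Theory.
Local Open Scope ring_scope.

(** Everything is defined over an arbitrary field; the notions have their
    intended meaning in characteristic 2, where d (x) 1 + 1 (x) d squares to
    zero and the braiding w (x) v + w' (x) v' is symmetric. *)

Record lieAlg (k : fieldType) := LieAlg {
  lie_sort :> vectType k;
  lie_br : {bilinear lie_sort -> lie_sort -> lie_sort};
  lie_brxx : forall x, lie_br x x = 0;
  lie_jacobi : forall x y z,
    lie_br (lie_br x y) z + lie_br (lie_br z x) y + lie_br (lie_br y z) x = 0
}.

Arguments lie_br {k} l.

Definition lie_iso (k : fieldType) (g h : lieAlg k) : Prop :=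
  exists phi : {linear g -> h}, bijective phi /\
    forall x y, phi (lie_br g x y) = lie_br h (phi x) (phi y).

Section Heisenberg.
Variable k : fieldType.

Definition heis_sort : vectType k := (k^o * k^o * k^o)%type.

Definition heis_bracket (a b : heis_sort) : heis_sort :=
  ((0, 0), a.1.1 * b.1.2 - a.1.2 * b.1.1).

Fact heis_bracket_bilinear : bilinear_for *:%R *:%R heis_bracket.
Proof.
have El (c a1 a2 b1 b2 u1 u2 : k) :
  (c * a1 + b1) * u2 - (c * a2 + b2) * u1
  = c * (a1 * u2 - a2 * u1) + (b1 * u2 - b2 * u1) by ring.
have Er (c a1 a2 b1 b2 u1 u2 : k) :
  u1 * (c * a2 + b2) - u2 * (c * a1 + b1)
  = c * (u1 * a2 - u2 * a1) + (u1 * b2 - u2 * b1) by ring.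
split=> u c a b; congr (_, _, _); rewrite /= ?scaler0 ?addr0 //.
  exact: El.
exact: Er.
Qed.

HB.instance Definition _ :=
  bilinear_isBilinear.Build k heis_sort heis_sort heis_sort *:%R *:%R
    heis_bracket heis_bracket_bilinear.

Fact heis_brxx (a : heis_sort) : heis_bracket a a = 0.
Proof. by congr (_, _, _); rewrite /= mulrC subrr. Qed.

Fact heis_jacobi (a b c : heis_sort) :
  heis_bracket (heis_bracket a b) c + heis_bracket (heis_bracket c a) b
  + heis_bracket (heis_bracket b c) a = 0.
Proof.
have E (a1 a2 b1 b2 c1 c2 : k) :
  (0 * c2 - 0 * c1) + (0 * b2 - 0 * b1) + (0 * a2 - 0 * a1) = 0 by ring.
by congr (_, _, _); rewrite /= ?addr0 //; exact: E.
Qed.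

(** Basis x = (1,0,0), y = (0,1,0), z = (0,0,1), with [x,y] = z central. *)
Definition heisenberg : lieAlg k := LieAlg heis_brxx heis_jacobi.

End Heisenberg.

Record ver4 (k : fieldType) := Ver4 {
  ver4_sort :> vectType k;
  ver4_d : 'End(ver4_sort);
  ver4_dd : forall x, ver4_d (ver4_d x) = 0
}.

Definition ver4_obj_iso (k : fieldType) (V W : ver4 k) : Prop :=
  exists phi : {linear V -> W}, bijective phi /\
    forall x, phi (ver4_d V x) = ver4_d W (phi x).

Section Objects.
Variable k : fieldType.

Fact unit_dd (x : k^o) : (0 : 'End(k^o)) ((0 : 'End(k^o)) x) = 0.
Proof. by rewrite zero_lfunE. Qed.

Definition ver4_unit : ver4 k := Ver4 unit_dd.

(** P = k[d]/d^2, with a + b d encoded as (a, b). *)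
Definition P_sort : vectType k := (k^o * k^o)%type.

Definition P_dfun (p : P_sort) : P_sort := (0, p.1).

Fact P_dfun_linear : linear P_dfun.
Proof. by move=> c p q; congr (_, _); rewrite /= scaler0 addr0. Qed.

HB.instance Definition _ :=
  GRing.isLinear.Build k P_sort P_sort _ P_dfun P_dfun_linear.

Fact P_dd (p : P_sort) : linfun P_dfun (linfun P_dfun p) = 0.
Proof. by rewrite !lfunE. Qed.

Definition ver4_P : ver4 k := Ver4 P_dd.

Section Sum.
Variables V W : ver4 k.

Definition sum_sort : vectType k := (V * W)%type.

Definition sum_dfun (p : sum_sort) : sum_sort := (ver4_d V p.1, ver4_d W p.2).

Fact sum_dfun_linear : linear sum_dfun.
Proof. by move=> c p q; congr (_, _); rewrite /= linearP. Qed.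

HB.instance Definition _ :=
  GRing.isLinear.Build k sum_sort sum_sort _ sum_dfun sum_dfun_linear.

Fact sum_dd (p : sum_sort) : linfun sum_dfun (linfun sum_dfun p) = 0.
Proof. by rewrite !lfunE; congr (_, _); exact: ver4_dd. Qed.

Definition ver4_sum : ver4 k := Ver4 sum_dd.

End Sum.
End Objects.

Record is_ver4_lie (k : fieldType) (V : ver4 k)
    (br : {bilinear V -> V -> V}) : Prop := IsVer4Lie {
  ver4_lie_d : forall x y,
    ver4_d V (br x y) = br (ver4_d V x) y + br x (ver4_d V y);
  ver4_lie_sym : forall x y,
    br x y + br y x + br (ver4_d V y) (ver4_d V x) = 0;
  ver4_lie_jacobi : forall x y z,
    br (br x y) z + br (br z x) y + br (br y z) x
    + br (br (ver4_d V x) y) (ver4_d V z)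
    + br (br (ver4_d V z) x) (ver4_d V y)
    + br (br (ver4_d V y) z) (ver4_d V x) = 0;
  ver4_lie_xx : forall x, ver4_d V x = 0 -> br x x = 0
}.

Record ver4_lie (k : fieldType) := Ver4Lie {
  ver4_obj :> ver4 k;
  ver4_br : {bilinear ver4_obj -> ver4_obj -> ver4_obj};
  ver4_lieP : is_ver4_lie ver4_br
}.

Arguments ver4_br {k} v.

Definition ver4_lie_iso (k : fieldType) (g h : ver4_lie k) : Prop :=
  exists phi : {linear g -> h}, [/\ bijective phi,
    forall x, phi (ver4_d g x) = ver4_d h (phi x) &
    forall x y, phi (ver4_br g x y) = ver4_br h (phi x) (phi y)].

Section Kernel.
Variables (k : fieldType) (g : ver4_lie k).

Definition ker_sort : vectType k := subvs_of (lker (ver4_d g)).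

Fact ker_d (x : ker_sort) : ver4_d g (vsval x) = 0.
Proof. by apply/eqP; rewrite -memv_ker (valP x). Qed.

Fact ker_br_mem (x y : ker_sort) :
  ver4_br g (vsval x) (vsval y) \in lker (ver4_d g).
Proof.
by rewrite memv_ker (ver4_lie_d (ver4_lieP g)) !ker_d linear0l linear0r addr0.
Qed.

Definition ker_bracket (x y : ker_sort) : ker_sort := Subvs (ker_br_mem x y).

Fact ker_bracket_bilinear : bilinear_for *:%R *:%R ker_bracket.
Proof.
by split=> u c a b; apply: val_inj; rewrite /= ?linearPl ?linearPr.
Qed.

HB.instance Definition _ :=
  bilinear_isBilinear.Build k ker_sort ker_sort ker_sort *:%R *:%R
    ker_bracket ker_bracket_bilinear.

Fact ker_brxx (x : ker_sort) : ker_bracket x x = 0.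
Proof. by apply: val_inj; apply: (ver4_lie_xx (ver4_lieP g)); apply: ker_d. Qed.

Fact ker_jacobi (x y z : ker_sort) :
  ker_bracket (ker_bracket x y) z + ker_bracket (ker_bracket z x) y
  + ker_bracket (ker_bracket y z) x = 0.
Proof.
apply: val_inj; have /= := ver4_lie_jacobi (ver4_lieP g) (val x) (val y) (val z).
by rewrite !ker_d !linear0r !addr0.
Qed.

Definition ker_lie : lieAlg k := LieAlg ker_brxx ker_jacobi.

End Kernel.

Definition twounit_P (k : fieldType) : ver4 k :=
  ver4_sum (ver4_sum (ver4_unit k) (ver4_unit k)) (ver4_P k).

Record in_class (k : fieldType) (g : ver4_lie k) : Prop := InClass {
  in_class_obj : ver4_obj_iso g (twounit_P k);
  in_class_f0 : forall v w : g,
    w \in lker (ver4_d g) -> ver4_br g v w \in lker (ver4_d g);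
  in_class_heis : lie_iso (ker_lie g) (heisenberg k)
}.

Section List.
Variable k : fieldType.
Local Notation V := (twounit_P k).

Let comb5 (W : lmodType k) (c p1 p2 p3 p4 p5 q1 q2 q3 q4 q5 : k)
    (w1 w2 w3 w4 w5 : W) :
  (c * p1 + q1) *: w1 + (c * p2 + q2) *: w2 + (c * p3 + q3) *: w3
    + (c * p4 + q4) *: w4 + (c * p5 + q5) *: w5
  = c *: (p1 *: w1 + p2 *: w2 + p3 *: w3 + p4 *: w4 + p5 *: w5)
    + (q1 *: w1 + q2 *: w2 + q3 *: w3 + q4 *: w4 + q5 *: w5).
Proof.
rewrite !scalerDl !scalerDr -!scalerA.
by do 4![rewrite [RHS]addrACA; congr (_ + _)].
Qed.

Let bil_l (W : lmodType k) (w1 w2 w3 w4 w5 : W)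
    (c ax ay av ad bx by0 bv bd ux uy uv ud : k) :
  ((c * ax + bx) * uy + (c * ay + by0) * ux) *: w1
  + ((c * av + bv) * uv) *: w2
  + ((c * av + bv) * ud + (c * ad + bd) * uv) *: w3
  + ((c * av + bv) * ux + (c * ax + bx) * uv) *: w4
  + ((c * av + bv) * uy + (c * ay + by0) * uv) *: w5
  = c *: ((ax * uy + ay * ux) *: w1 + (av * uv) *: w2
          + (av * ud + ad * uv) *: w3 + (av * ux + ax * uv) *: w4
          + (av * uy + ay * uv) *: w5)
    + ((bx * uy + by0 * ux) *: w1 + (bv * uv) *: w2
       + (bv * ud + bd * uv) *: w3 + (bv * ux + bx * uv) *: w4
       + (bv * uy + by0 * uv) *: w5).
Proof.
rewrite -comb5.
by congr (_ *: _ + _ *: _ + _ *: _ + _ *: _ + _ *: _); ring.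
Qed.

Let bil_r (W : lmodType k) (w1 w2 w3 w4 w5 : W)
    (c ax ay av ad bx by0 bv bd ux uy uv ud : k) :
  (ux * (c * ay + by0) + uy * (c * ax + bx)) *: w1
  + (uv * (c * av + bv)) *: w2
  + (uv * (c * ad + bd) + ud * (c * av + bv)) *: w3
  + (uv * (c * ax + bx) + ux * (c * av + bv)) *: w4
  + (uv * (c * ay + by0) + uy * (c * av + bv)) *: w5
  = c *: ((ux * ay + uy * ax) *: w1 + (uv * av) *: w2
          + (uv * ad + ud * av) *: w3 + (uv * ax + ux * av) *: w4
          + (uv * ay + uy * av) *: w5)
    + ((ux * by0 + uy * bx) *: w1 + (uv * bv) *: w2
       + (uv * bd + ud * bv) *: w3 + (uv * bx + ux * bv) *: w4
       + (uv * by0 + uy * bv) *: w5).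
Proof.
rewrite -comb5.
by congr (_ *: _ + _ *: _ + _ *: _ + _ *: _ + _ *: _); ring.
Qed.

(** Basis of 2*1 + P: x, y of the summand 2*1, and v, v' = dv of P. *)
Definition e_x : V := ((1, 0), (0, 0)).
Definition e_y : V := ((0, 1), (0, 0)).
Definition e_v : V := ((0, 0), (1, 0)).
Definition e_v' : V := ((0, 0), (0, 1)).

(** The bilinear bracket with [x,y] = [y,x] = v', all other brackets among
    x, y, v' zero, [v,v] = vv, [v,v'] = vv', [v,x] = vx, [v,y] = vy, and
    [w,v] = [v,w] for w in ker d. *)
Definition table (vv vv' vx vy : V) (a b : V) : V :=
  (a.1.1 * b.1.2 + a.1.2 * b.1.1) *: e_v'
  + (a.2.1 * b.2.1) *: vv
  + (a.2.1 * b.2.2 + a.2.2 * b.2.1) *: vv'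
  + (a.2.1 * b.1.1 + a.1.1 * b.2.1) *: vx
  + (a.2.1 * b.1.2 + a.1.2 * b.2.1) *: vy.

Fact table_bilinear (vv vv' vx vy : V) :
  bilinear_for *:%R *:%R (table vv vv' vx vy).
Proof.
split=> u c a b; rewrite /table.
  exact: (bil_l e_v' vv vv' vx vy c a.1.1 a.1.2 a.2.1 a.2.2
    b.1.1 b.1.2 b.2.1 b.2.2 u.1.1 u.1.2 u.2.1 u.2.2).
exact: (bil_r e_v' vv vv' vx vy c a.1.1 a.1.2 a.2.1 a.2.2
  b.1.1 b.1.2 b.2.1 b.2.2 u.1.1 u.1.2 u.2.1 u.2.2).
Qed.
HB.instance Definition _ (vv vv' vx vy : V) :=
  bilinear_isBilinear.Build k V V V *:%R *:%R
    (table vv vv' vx vy) (table_bilinear vv vv' vx vy).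

Inductive listed : {bilinear V -> V -> V} -> Prop :=
| row1_1 (l : k) : listed (table 0 0 0 (l *: e_x))
| row1_2 (l : k) : listed (table 0 0 e_x (l *: e_x + e_y))
| row1_3 (l : k) : listed (table 0 e_v' (l *: e_x) ((l + 1) *: e_y))
| row1_4 (l : k) : listed (table e_v' 0 0 (l *: e_x))
| row1_5 (l m : k) : listed (table (l *: e_v') 0 e_x (m *: e_x + e_y)).

End List.

(* Main.v *)
Require Import Defs.
From HB Require Import structures.
From mathcomp Require Import all_boot all_order all_algebra ring.
Import GRing.Theory.
Local Open Scope ring_scope.

(** Let g be a Lie algebra of the class, L = ker d and v a vector with
    dv <> 0. Applying d to [v,w] for w in L gives [dv,w] = 0, so dv spans the
    center of the Heisenberg algebra L, and x, y in L can be chosen with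
    [x,y] = dv. Such a triple is a frame: x, y, v, dv is a basis of g
    (lemmas [frame_inj] and [frame_inv]).

    The Jacobi identity on (x,y,v) says that D = [v,-] is a derivation of L.
    Replacing v by v + q x + p y changes D by an inner derivation, which kills
    the dv-components of Dx and Dy, so D is given by a 2 x 2 matrix A on x, y
    and D(dv) = tr(A) dv. The Jacobi identity on (v,v,w) with w in L makes
    [v,v] central, say [v,v] = nu dv, and the one on (v,v,v) says
    nu tr(A) = 0 ([gl_frame_exists], [gl_frame_trace], [gl_frame_nu]).
    Conversely every pair (A, nu) with nu tr(A) = 0 defines an algebra of the
    class ([gl_bracket_lie], [gl_bracket_in_class]), and it determines g up to
    isomorphism ([gl_frame_iso]).

    It remains to find a normal form of (A, nu). A change of x, y by a matrix M
    forces v to be replaced by det(M) v, so it conjugates A and multiplies A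
    and nu by det(M) ([gl_frame_change]); over an algebraically closed field
    scalar matrices M realize every nonzero factor. If tr(A) <> 0 then nu = 0
    and the eigenvalues of A differ by tr(A), which scales to 1: [row1_3]. If
    tr(A) = 0, in characteristic 2 the two eigenvalues coincide; A is made
    triangular, and one scales the eigenvalue to 1 ([row1_5], which for nu = 0
    is [row1_2]) or, if it vanishes, nu to 1 ([row1_4]), unless nu = 0 too
    ([row1_1]). *)

Set Implicit Arguments.
Unset Strict Implicit.
Unset Printing Implicit Defensive.

(** * The algebras given by a matrix and a scalar *)

Section MatrixAlgebras.
Variable k : fieldType.
Hypothesis char2 : 2%N \in [pchar k].
Local Notation V := (twounit_P k).

(** Given an equation between constants, [ring] replaces only coefficients
    equal to its left-hand side, so each coefficient that occurs in a normal
    form below has to be reduced mod 2 by an equation of its own. *)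
Fact two0 : 2%:R = 0 :> k.
Proof. exact: pcharf0. Qed.

Fact three1 : 3%:R = 1 :> k.
Proof. by rewrite -[3%N]/(1 + 2)%N natrD two0 addr0. Qed.

Fact four0 : 4%:R = 0 :> k.
Proof. by rewrite -[4%N]/(2 + 2)%N natrD two0 addr0. Qed.

Fact six0 : 6%:R = 0 :> k.
Proof. by rewrite -[6%N]/(2 + 4)%N natrD two0 add0r four0. Qed.

Lemma addv_self (W : lmodType k) (w : W) : w + w = 0.
Proof. by rewrite -mulr2n -scaler_nat two0 scale0r. Qed.

(** The formulas for d and the bracket are stated on bare quadruples of
    scalars, away from the vector space structures of the object, so that the
    Jacobi identity becomes four scalar identities. *)
Definition d_coord (p : k * k * (k * k)) : k * k * (k * k) :=
  ((0, 0), (0, p.2.1)).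

Lemma twounit_P_dE (p : V) : ver4_d V p = d_coord p.
Proof.
by rewrite /= lfunE /= /sum_dfun /= !lfunE /= /sum_dfun /= !zero_lfunE.
Qed.

Definition br_coord (nu a b c e : k) (p q : k * k * (k * k)) : k * k * (k * k) :=
  ((a * (p.2.1 * q.1.1 + p.1.1 * q.2.1) + c * (p.2.1 * q.1.2 + p.1.2 * q.2.1),
    b * (p.2.1 * q.1.1 + p.1.1 * q.2.1) + e * (p.2.1 * q.1.2 + p.1.2 * q.2.1)),
   (0,
    p.1.1 * q.1.2 + p.1.2 * q.1.1 + nu * (p.2.1 * q.2.1)
    + (a + e) * (p.2.1 * q.2.2 + p.2.2 * q.2.1))).

(** In the v' coordinate the terms without a factor nu (a + e) cancel in pairs:
    [v,-] acts as a derivation on x, y, v'. *)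
Lemma jacobi_coord (nu a b c e : k) p q r : nu * (a + e) = 0 ->
  let B := br_coord nu a b c e in let D := d_coord in
  B (B p q) r + B (B r p) q + B (B q r) p
  + B (B (D p) q) (D r) + B (B (D r) p) (D q) + B (B (D q) r) (D p) = 0.
Proof.
move=> nutr /=.
case: p q r => [[p1 p2] [p3 p4]] [[q1 q2] [q3 q4]] [[r1 r2] [r3 r4]].
congr ((_, _), (_, _)); rewrite /=; try by ring: two0 three1 four0.
(* 3 nu (a + e) p3 q3 r3 is what remains: it is the term [[v,v],v]. *)
transitivity (p3 * q3 * r3 * (nu * (a + e))); last by rewrite nutr mulr0.
by ring: two0 three1 four0 six0.
Qed.

(** [v,-] acts on x, y by the matrix A with rows (a, b) and (c, e). The value
    tr(A) v' of [v,v'] is forced by v' = [x,y] and the derivation property. *)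
Definition gl_bracket (nu a b c e : k) : {bilinear V -> V -> V} :=
  table (nu *: e_v' k) ((a + e) *: e_v' k) (a *: e_x k + b *: e_y k)
   (c *: e_x k + e *: e_y k).

Lemma gl_bracketE (nu a b c e : k) (p q : V) :
  gl_bracket nu a b c e p q = br_coord nu a b c e p q.
Proof.
case: p q => [[p1 p2] [p3 p4]] [[q1 q2] [q3 q4]].
by congr ((_, _), (_, _)); rewrite /= /GRing.scale /=; ring.
Qed.

Lemma gl_bracket_lie (nu a b c e : k) :
  nu * (a + e) = 0 -> is_ver4_lie (gl_bracket nu a b c e).
Proof.
move=> nutr; move: (gl_bracketE nu a b c e).
(* Only the coordinate formula matters; with an opaque bracket, rewriting by
   it does not unfold [table]. *)
generalize (gl_bracket nu a b c e) => br brE; split.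
- move=> p q; rewrite !twounit_P_dE !brE.
  by congr ((_, _), (_, _)); rewrite /=; ring: two0.
- move=> p q; rewrite !twounit_P_dE !brE.
  by congr ((_, _), (_, _)); rewrite /=; ring: two0.
- move=> p q r; rewrite !twounit_P_dE !brE.
  exact: jacobi_coord.
- move=> p; rewrite twounit_P_dE => -[p0]; rewrite brE /br_coord p0.
  by congr ((_, _), (_, _)); rewrite /=; ring: two0.
Qed.

Lemma gl_bracket_in_class (nu a b c e : k)
    (lieP : is_ver4_lie (gl_bracket nu a b c e)) :
  in_class (Ver4Lie lieP).
Proof.
have kerE (w : V) : (w \in lker (ver4_d V)) = (w.2.1 == 0).
  rewrite memv_ker twounit_P_dE; apply/eqP/eqP => [[]//|w0].
  by rewrite /d_coord w0.
split.
- by exists idfun; split => //; exists idfun.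
- by move=> p q; rewrite !kerE gl_bracketE.
  (* The kernel of d has basis x, y, v', and v' corresponds to z = [x,y]. *)
- pose f (w : ker_lie (Ver4Lie lieP)) : heisenberg k :=
    (((vsval w).1.1, (vsval w).1.2), (vsval w).2.2).
  have vP t (u v : ker_lie (Ver4Lie lieP)) :
    vsval (t *: u + v) = t *: vsval u + vsval v by exact: linearP.
  have flin : linear f by move=> t u v; rewrite /f vP.
  pose F : {linear _ -> _} := HB.pack f (GRing.isLinear.Build _ _ _ _ f flin).
  exists F; split; last first.
    move=> x y; have val0 (w : ker_lie (Ver4Lie lieP)) : (vsval w).2.1 = 0.
      by apply/eqP; rewrite -kerE; exact: valP w.
    have kP : vsval (lie_br (ker_lie (Ver4Lie lieP)) x y)
        = br_coord nu a b c e (vsval x) (vsval y) by exact: gl_bracketE.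
    change (f (lie_br (ker_lie (Ver4Lie lieP)) x y) = heis_bracket (f x) (f y)).
    rewrite /f kP /br_coord !val0.
    by congr (_, _, _); rewrite /= ?(oppr_pchar2 char2); ring.
  have gm (t : heisenberg k) :
    (((t.1.1, t.1.2), (0, t.2)) : V) \in lker (ver4_d V) by rewrite kerE.
  exists (fun t => Subvs (gm t)).
    move=> w; apply: val_inj; have := valP w; rewrite kerE /=.
    by case: (val w) => [[p1 p2] [p3 p4]] /= /eqP ->.
  by move=> [[t1 t2] t3].
Qed.
End MatrixAlgebras.

(** * Frames of a Lie algebra of the class *)

Section Char2.
Variable k : fieldType.
Hypothesis char2 : 2%N \in [pchar k].
Local Notation V := (twounit_P k).

Lemma eq_of_addv0 (W : lmodType k) (u w : W) : u + w = 0 -> u = w.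
Proof. by move=> uw; rewrite -[u]addr0 -(addv_self char2 w) addrA uw add0r. Qed.

Lemma comb2 (W : lmodType k) (x y : W) (r s a b c e : k) :
  r *: (a *: x + b *: y) + s *: (c *: x + e *: y)
  = (r * a + s * c) *: x + (r * b + s * e) *: y.
Proof. by rewrite !scalerDr !scalerA addrACA -!scalerDl. Qed.

Section FrameMap.
Variables (g : ver4 k) (x y v : g).

Definition frame_map (p : V) : g :=
  p.1.1 *: x + p.1.2 *: y + p.2.1 *: v + p.2.2 *: ver4_d g v.

Fact frame_map_linear : linear frame_map.
Proof.
move=> t p q; rewrite /frame_map !scalerDl !scalerDr -!scalerA.
by do 3![rewrite [RHS]addrACA; congr (_ + _)].
Qed.
HB.instance Definition _ :=
  GRing.isLinear.Build k V g _ frame_map frame_map_linear.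
End FrameMap.

Section Frames.
Variable g : ver4_lie k.
Local Notation d := (ver4_d g).
Local Notation br := (ver4_br g).
Let lieP := ver4_lieP g.

Lemma brC u w : d w = 0 -> br u w = br w u.
Proof.
move=> dw; apply: eq_of_addv0.
by have := ver4_lie_sym lieP u w; rewrite dw linear0l addr0.
Qed.

Lemma br_kxx w : d w = 0 -> br w w = 0.
Proof. exact: ver4_lie_xx lieP w. Qed.

(** The character f of ker d on g / ker d vanishes. *)
Hypothesis f0 : forall v w : g, d w = 0 -> d (br v w) = 0.

(** Apply d to [v,w], which lies in ker d: this is why dv is central there. *)
Lemma br_im_ker v w : d w = 0 -> br (d v) w = 0.
Proof.
by move=> dw; have := ver4_lie_d lieP v w; rewrite f0 // dw linear0r addr0.
Qed.

Lemma br_ker_im v w : d w = 0 -> br w (d v) = 0.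
Proof. by move=> dw; rewrite brC ?ver4_dd // br_im_ker. Qed.

Definition heis_frame x y v := [/\ d x = 0, d y = 0, br x y = d v & d v != 0].

Lemma d_frame_map x y v p : heis_frame x y v ->
  d (frame_map x y v p) = p.2.1 *: d v.
Proof.
case=> dx dy _ _.
by rewrite /frame_map !linearD !linearZ /= dx dy ver4_dd !scaler0 !add0r addr0.
Qed.

Lemma br_frame_x x y v s t n : heis_frame x y v ->
  br (s *: x + t *: y + n *: d v) x = t *: d v.
Proof.
case=> dx dy xy _.
rewrite !linearDl !linearZl_LR /= br_kxx // -(brC x) // xy br_im_ker //.
by rewrite !scaler0 add0r addr0.
Qed.

Lemma br_frame_y x y v s t n : heis_frame x y v ->
  br (s *: x + t *: y + n *: d v) y = s *: d v.
Proof.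
case=> dx dy xy _.
rewrite !linearDl !linearZl_LR /= (br_kxx dy) xy br_im_ker //.
by rewrite !scaler0 !addr0.
Qed.

(** In a relation p1 x + p2 y + p3 v + p4 dv = 0, applying d kills p3, and
    bracketing with x and y kills p2 and p1. *)
Lemma frame_inj x y v : heis_frame x y v -> injective (frame_map x y v).
Proof.
move=> fr; have [dx dy xy dv] := fr; apply: raddf_inj => p p0.
have p3 : p.2.1 = 0.
  have := d_frame_map p fr; rewrite p0 linear0 => /esym/eqP.
  by rewrite scaler_eq0 (negPf dv) orbF => /eqP.
have {}p0 : p.1.1 *: x + p.1.2 *: y + p.2.2 *: d v = 0.
  by rewrite -[RHS]p0 /= /frame_map p3 scale0r addr0.
have p2 : p.1.2 = 0.
  have := br_frame_x p.1.1 p.1.2 p.2.2 fr; rewrite p0 linear0l => /esym/eqP.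
  by rewrite scaler_eq0 (negPf dv) orbF => /eqP.
have p1 : p.1.1 = 0.
  have := br_frame_y p.1.1 p.1.2 p.2.2 fr; rewrite p0 linear0l => /esym/eqP.
  by rewrite scaler_eq0 (negPf dv) orbF => /eqP.
move: p0; rewrite p1 p2 !scale0r !add0r => /eqP.
rewrite scaler_eq0 (negPf dv) orbF => /eqP p4.
by case: p p1 p2 p3 p4 => [[? ?] [? ?]] /= -> -> -> ->.
Qed.

Hypothesis objP : ver4_obj_iso g V.

(** The frame map is injective between spaces of the same dimension. It has to
    be composed with an isomorphism from g to the standard object in order to
    be an endomorphism, for which injectivity gives an inverse. *)
Lemma frame_inv x y v : heis_frame x y v ->
  exists G : {linear g -> V},
    cancel (frame_map x y v) G /\ cancel G (frame_map x y v).
Proof.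
move=> fr; have [phi [phi_bij _]] := objP.
pose f : 'End(V) := linfun (phi \o frame_map x y v).
have f0' : lker f == 0%VS.
  apply/lker0P => p q; rewrite !lfunE /= => /(bij_inj phi_bij).
  exact: frame_inj fr p q.
exists (f^-1%VF \o phi); split=> [p | u] /=.
  by have := lker0_lfunK f0' p; rewrite [f p]lfunE.
by apply: (bij_inj phi_bij); have := lker0_lfunVK f0' (phi u); rewrite lfunE.
Qed.

Lemma ker_coord x y v w : heis_frame x y v -> d w = 0 ->
  exists s t n, w = s *: x + t *: y + n *: d v.
Proof.
move=> fr dw; have [G [_ GK]] := frame_inv fr; move: dw; rewrite -[w]GK.
move: (G w) => p; rewrite d_frame_map // => /eqP; have [_ _ _ dv] := fr.
rewrite scaler_eq0 (negPf dv) orbF => /eqP p3.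
by exists p.1.1, p.1.2, p.2.2; rewrite /frame_map p3 scale0r addr0.
Qed.

(** A frame in which g has the structure constants of [gl_bracket]; the value
    of [v,dv] follows ([gl_frame_trace]). *)
Definition gl_frame nu a b c e x y v := heis_frame x y v /\
  [/\ br v v = nu *: d v, br v x = a *: x + b *: y & br v y = c *: x + e *: y].

(** Every frame can be corrected to one without dv-components in [v,x] and
    [v,y]. In the Jacobi identity on (w,v,v) the two terms [[v,w],v] cancel,
    which leaves [[v,v],w] = 0. *)
Lemma gl_frame_exists x y v : heis_frame x y v ->
  exists nu a b c e v1, gl_frame nu a b c e x y v1.
Proof.
move=> fr; have [dx dy xy dv] := fr.
have [a [b [p vx]]] := ker_coord fr (f0 v dx).
have [c [e [q vy]]] := ker_coord fr (f0 v dy).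
(* [y,x] = [x,y] = dv, so the p y term cancels p dv in [v,x], and
   symmetrically for q x in [v,y]. *)
pose v1 := v + q *: x + p *: y.
have dv1 : d v1 = d v by rewrite !linearD !linearZ /= dx dy !scaler0 !addr0.
have fr1 : heis_frame x y v1 by split; rewrite ?dv1.
have dvv : d (br v1 v1) = 0.
  by rewrite (ver4_lie_d lieP) (brC v1) ?ver4_dd // (addv_self char2).
have vvC w : d w = 0 -> br (br v1 v1) w = 0.
  move=> dw; have := ver4_lie_jacobi lieP w v1 v1.
  rewrite dw (brC v1 dw) (addv_self char2) add0r br_im_ker //.
  by rewrite !(linear0l, linear0r) !addr0.
have [s [t [nu vv]]] := ker_coord fr1 dvv.
have t0 : t = 0.
  have := vvC x dx; rewrite vv br_frame_x // dv1 => /eqP.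
  by rewrite scaler_eq0 (negPf dv) orbF => /eqP.
have s0 : s = 0.
  have := vvC y dy; rewrite vv br_frame_y // dv1 => /eqP.
  by rewrite scaler_eq0 (negPf dv) orbF => /eqP.
exists nu, a, b, c, e, v1; split=> //; split.
- by rewrite vv s0 t0 !scale0r !add0r.
- rewrite !linearDl !linearZl_LR /= vx br_kxx // -(brC x) // xy.
  by rewrite scaler0 addr0 -addrA (addv_self char2) addr0.
- rewrite !linearDl !linearZl_LR /= vy (br_kxx dy) xy.
  by rewrite scaler0 addr0 -addrA (addv_self char2) addr0.
Qed.

(** The trace of [v,-] on x, y governs its action on [x,y] = dv, because the
    Jacobi identity makes [v,-] a derivation of ker d. *)
Lemma gl_frame_trace nu a b c e x y v : gl_frame nu a b c e x y v ->
  br v (d v) = (a + e) *: d v.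
Proof.
case=> -[dx dy xy dv] [vv vx vy].
have ddv := ver4_dd v; rewrite (brC v ddv).
have := ver4_lie_jacobi lieP x y v.
rewrite xy vx -(brC v dy) vy dx dy (br_im_ker v dx) !(linear0l, linear0r) !addr0.
rewrite !linearDl !linearZl_LR /= (br_kxx dx) (br_kxx dy) xy -(brC x dy) xy.
by rewrite !scaler0 addr0 add0r -addrA -scalerDl => /eq_of_addv0.
Qed.

(** The Jacobi identity on (v,v,v) is 3 [[v,v],v] = 0. *)
Lemma gl_frame_nu nu a b c e x y v : gl_frame nu a b c e x y v ->
  nu * (a + e) = 0.
Proof.
move=> fr; have vd := gl_frame_trace fr; case: fr => -[dx dy xy dv] [vv vx vy].
have ddv := ver4_dd v; have dvC := brC v ddv.
have := ver4_lie_jacobi lieP v v v.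
rewrite vv -dvC vd !linearZl_LR /= -dvC vd br_kxx // scaler0 !addr0.
rewrite (addv_self char2) add0r scalerA => /eqP.
by rewrite scaler_eq0 (negPf dv) orbF => /eqP.
Qed.

Lemma gl_frame_iso nu a b c e x y v : gl_frame nu a b c e x y v ->
  exists lieQ : is_ver4_lie (gl_bracket nu a b c e),
    ver4_lie_iso g (Ver4Lie lieQ).
Proof.
move=> fr; have vd := gl_frame_trace fr; have nu0 := gl_frame_nu fr.
have [hfr [vv vx vy]] := fr; have [dx dy xy dv] := hfr.
exists (gl_bracket_lie char2 b c nu0); have [G [FK GK]] := frame_inv hfr.
have FG_bij : bijective G by exists (frame_map x y v).
exists G; split=> // [u | u w].
  apply: (can_inj FK); rewrite GK /= twounit_P_dE -{1}[u]GK d_frame_map //.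
  by rewrite /frame_map /= !scale0r !add0r.
apply: (can_inj FK); rewrite GK.
change (br u w = frame_map x y v (gl_bracket nu a b c e (G u) (G w))).
rewrite gl_bracketE -{1}[u]GK -{1}[w]GK.
case: (G u) => [[p1 p2] [p3 p4]]; case: (G w) => [[q1 q2] [q3 q4]].
rewrite /frame_map /br_coord /= scale0r addr0.
rewrite !linearDl !linearZl_LR /= !linearDr !linearZr_LR /=.
have ddv := ver4_dd v.
rewrite (br_kxx dx) (br_kxx dy) (br_kxx ddv) -(brC x dy).
rewrite !(br_im_ker v dx, br_im_ker v dy, br_ker_im v dx, br_ker_im v dy).
rewrite -(brC v dx) -(brC v dy) -(brC v ddv).
rewrite xy vv vx vy vd !scaler0 ?addr0 ?add0r.
rewrite !scalerDr !scalerA !addrA.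
(* Group the thirteen terms into the multiples of x, of y and of dv. *)
rewrite [LHS](AC 13%AC ((2*5*7*9)*(3*6*8*10)*(1*4*11*12*13))%AC).
rewrite /= -!scalerDl; congr (_ *: _ + _ *: _ + _ *: _); ring.
Qed.

(** With M the matrix of rows (r, s) and (t, u), the four equations say
    that det(M) M A = A1 M, so A1 = det(M) M A M^-1. The factor det(M) comes
    from d v1 = [x1,y1] = det(M) dv. The determinant is written with a plus
    sign, as the characteristic is 2. *)
Lemma gl_frame_change nu a b c e x y v r s t u a1 b1 c1 e1 :
    gl_frame nu a b c e x y v ->
  let m := r * u + s * t in m != 0 ->
  m * (r * a + s * c) = a1 * r + b1 * t ->
  m * (r * b + s * e) = a1 * s + b1 * u ->
  m * (t * a + u * c) = c1 * r + e1 * t ->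
  m * (t * b + u * e) = c1 * s + e1 * u ->
  gl_frame (m * nu) a1 b1 c1 e1 (r *: x + s *: y) (t *: x + u *: y) (m *: v).
Proof.
move=> [[dx dy xy dv] [vv vx vy]] m m0 E1 E2 E3 E4.
have dmv : d (m *: v) = m *: d v by rewrite linearZ.
have dcomb p q : d (p *: x + q *: y) = 0.
  by rewrite linearD !linearZ /= dx dy !scaler0 addr0.
split; split=> //.
- rewrite !linearDl !linearZl_LR /= !linearDr !linearZr_LR /=.
  rewrite (br_kxx dx) (br_kxx dy) -(brC x dy) xy dmv !scaler0 addr0 add0r.
  by rewrite !scalerA -scalerDl.
- by rewrite dmv scaler_eq0 negb_or m0.
- by rewrite !linearZl_LR !linearZr_LR /= vv dmv !scalerA; congr (_ *: _); ring.
- rewrite linearZl_LR linearDr !linearZr_LR /= vx vy !comb2 scalerDr !scalerA.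
  by rewrite E1 E2.
- rewrite linearZl_LR linearDr !linearZr_LR /= vx vy !comb2 scalerDr !scalerA.
  by rewrite E3 E4.
Qed.
End Frames.

(** Transported to the Heisenberg algebra, dv becomes a central element, hence
    n z = [n x, y] for a scalar n; pull back n x and y. *)
Lemma in_class_heis_frame (g : ver4_lie k) : in_class g ->
  exists x y v, heis_frame (g := g) x y v.
Proof.
case=> -[phi [phi_bij phi_d]] f0 [theta [[theta' thetaK theta'K] theta_br]].
have [psi phiK psiK] := phi_bij; pose v := psi (e_v k).
have dv : ver4_d g v != 0.
  apply: contra_neq (oner_neq0 k) => dv0; have := phi_d v.
  by rewrite dv0 linear0 psiK twounit_P_dE => -[].
have ddv : ver4_d g v \in lker (ver4_d g) by rewrite memv_ker ver4_dd.
pose z : ker_lie g := Subvs ddv.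
have zC w : lie_br (ker_lie g) z w = 0.
  apply: val_inj => /=; have := ver4_lie_d (ver4_lieP g) v (vsval w).
  rewrite ker_d linear0r addr0 => <-; apply/eqP.
  by rewrite -memv_ker f0 // (valP w).
have thzC h : heis_bracket (theta z) h = 0.
  by have := theta_br z (theta' h); rewrite zC linear0 theta'K.
case Ez : (theta z) => [[p q] n].
have p0 : p = 0.
  by have := thzC ((0, 1), 0); rewrite Ez => -[/=]; rewrite mulr1 mulr0 subr0.
have q0 : q = 0.
  have := thzC ((1, 0), 0); rewrite Ez => -[/=] /eqP.
  by rewrite mulr1 mulr0 sub0r oppr_eq0 => /eqP.
exists (vsval (theta' ((n, 0), 0))), (vsval (theta' ((0, 1), 0))), v.
split; rewrite ?ker_d //.
suff : lie_br (ker_lie g) (theta' ((n, 0), 0)) (theta' ((0, 1), 0)) = z.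
  by move/(congr1 vsval).
apply: (can_inj thetaK); rewrite theta_br !theta'K Ez p0 q0 /=.
by congr (_, _, _); rewrite /= mulr1 mulr0 subr0.
Qed.

End Char2.

(** * Normal forms and the list *)

Section Rows.
Variable k : fieldType.
Hypothesis char2 : 2%N \in [pchar k].
Local Notation V := (twounit_P k).

Lemma row1_1E (l : k) :
  table 0 0 0 (l *: e_x k) = gl_bracket 0 0 0 l 0 :> {bilinear V -> V -> V}.
Proof. by rewrite /gl_bracket !addr0 !scale0r !addr0. Qed.

Lemma row1_5E (n l : k) :
  table (n *: e_v' k) 0 (e_x k) (l *: e_x k + e_y k) = gl_bracket n 1 0 l 1
    :> {bilinear V -> V -> V}.
Proof.
by rewrite /gl_bracket (addv_self char2 (1 : k^o)) !scale0r !scale1r addr0.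
Qed.

Lemma row1_2E (l : k) :
  table 0 0 (e_x k) (l *: e_x k + e_y k) = gl_bracket 0 1 0 l 1
    :> {bilinear V -> V -> V}.
Proof. by rewrite -row1_5E scale0r. Qed.

Lemma row1_3E (l : k) :
  table 0 (e_v' k) (l *: e_x k) ((l + 1) *: e_y k) = gl_bracket 0 l 0 0 (l + 1)
    :> {bilinear V -> V -> V}.
Proof.
rewrite /gl_bracket addrA (addv_self char2 (l : k^o)) add0r scale1r.
by rewrite !scale0r add0r addr0.
Qed.

Lemma row1_4E (l : k) :
  table (e_v' k) 0 0 (l *: e_x k) = gl_bracket 1 0 0 l 0
    :> {bilinear V -> V -> V}.
Proof. by rewrite /gl_bracket !addr0 scale1r !scale0r !addr0. Qed.

Lemma listed_gl_bracket (br : {bilinear V -> V -> V}) : listed br ->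
  exists nu a b c e, br = gl_bracket nu a b c e /\ nu * (a + e) = 0.
Proof.
have one2 : 1 + 1 = 0 :> k by exact: two0.
case=> [l | l | l | l | n l].
- by exists 0, 0, 0, l, 0; rewrite row1_1E mul0r.
- by exists 0, 1, 0, l, 1; rewrite row1_2E mul0r.
- by exists 0, l, 0, 0, (l + 1); rewrite row1_3E mul0r.
- by exists 1, 0, 0, l, 0; rewrite row1_4E addr0 mulr0.
- by exists n, 1, 0, l, 1; rewrite row1_5E one2 mulr0.
Qed.
End Rows.

Section Closed.
Variable k : closedFieldType.
Hypothesis char2 : 2%N \in [pchar k].

Lemma exists_sqrt (m : k) : exists t, t * t = m.
Proof.
have [t tE] :=
  solve_monicpoly (fun i => if i is 0 then m else 0) (isT : 0 < 2)%N.
by exists t; rewrite -expr2 tE !big_ord_recl big_ord0 /= mulr1 mul0r !addr0.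
Qed.

(** The characteristic equation (l - a) (l - e) = b c in characteristic 2. *)
Lemma exists_eigenvalue (a b c e : k) :
  exists l, (l + a) * (l + e) = b * c.
Proof.
have [l lE] := solve_monicpoly
  (fun i => if i is 0 then a * e + b * c else a + e) (isT : 0 < 2)%N.
have {}lE : l * l = a * e + b * c + (a + e) * l.
  by rewrite -expr2 lE !big_ord_recl big_ord0 /= mulr1 addr0.
exists l; have -> : (l + a) * (l + e) = l * l + (a + e) * l + a * e by ring.
by rewrite lE; ring: (two0 char2).
Qed.

Variable g : ver4_lie k.
Hypothesis f0 : forall v w : g,
  ver4_d g w = 0 -> ver4_d g (ver4_br g v w) = 0.

Definition has_gl_frame nu a b c e :=
  exists x y v : g, gl_frame nu a b c e x y v.

Lemma triangular_frame nu a b c e : has_gl_frame nu a b c e ->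
  exists a1 c1 e1, has_gl_frame nu a1 0 c1 e1.
Proof.
case=> [x [y [v fr]]]; have [b0 | b_neq0] := eqVneq b 0.
  by rewrite b0 in fr; exists a, c, e, x, y, v.
have [l lE] := exists_eigenvalue a b c e.
(* (l + e) x + b y is an eigenvector for l. Completing it by x / b gives a
   change of basis of determinant 1, so v is unchanged; the other eigenvalue
   is tr(A) - l. *)
exists l, b^-1, (a + e + l), ((l + e) *: x + b *: y), (b^-1 *: x + 0 *: y), v.
have two := two0 char2.
have bV : b * b^-1 = 1 by rewrite divff.
have m1 : (l + e) * 0 + b * b^-1 = 1 by rewrite bV mulr0 add0r.
have := gl_frame_change char2 (r := l + e) (s := b) (t := b^-1) (u := 0)
  (a1 := l) (b1 := 0) (c1 := b^-1) (e1 := a + e + l) fr.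
rewrite /= m1 scale1r !mul1r; apply; first exact: oner_neq0.
- transitivity (l * (l + e) + ((l + a) * (l + e) + b * c)).
    by ring: two.
  by rewrite lE; ring: two.
- by ring: two.
- by ring: two.
- by rewrite mulrC; ring: two.
Qed.

(** Use the scalar matrix t with t^2 = m: conjugation by it is trivial, and its
    determinant is m. *)
Lemma scaled_frame m nu a c e : m != 0 -> has_gl_frame nu a 0 c e ->
  has_gl_frame (m * nu) (m * a) 0 (m * c) (m * e).
Proof.
move=> m0 [x [y [v fr]]]; have [t tt] := exists_sqrt m.
exists (t *: x + 0 *: y), (0 *: x + t *: y), (m *: v).
have mE : t * t + 0 * 0 = m by rewrite mulr0 addr0.
have := gl_frame_change char2 (r := t) (s := 0) (t := 0) (u := t)
  (a1 := m * a) (b1 := 0) (c1 := m * c) (e1 := m * e) fr.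
by rewrite /= mE; apply=> //; ring.
Qed.

Lemma diagonal_frame nu a c e : a != e -> has_gl_frame nu a 0 c e ->
  has_gl_frame nu a 0 0 e.
Proof.
move=> ae [x [y [v fr]]]; pose h := c / (e - a).
have hE : c = h * (e - a) by rewrite /h divfK // subr_eq0 eq_sym.
(* y + h x is an eigenvector for e iff c + h a = h e. *)
exists x, (h *: x + y), v.
have mE : 1 * 1 + 0 * h = 1 by rewrite mul0r addr0 mulr1.
have := gl_frame_change char2 (r := 1) (s := 0) (t := h) (u := 1)
  (a1 := a) (b1 := 0) (c1 := 0) (e1 := e) fr.
rewrite /= mE !scale1r scale0r (addr0 x) !mul1r; apply;
  by rewrite ?oner_neq0 // ?hE; ring.
Qed.

Lemma normal_form nu a b c e : has_gl_frame nu a b c e ->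
  exists nu' a' b' c' e',
    listed (gl_bracket nu' a' b' c' e') /\ has_gl_frame nu' a' b' c' e'.
Proof.
move/triangular_frame => [{b}a1 [{}c [{}e fr]]]; move: a1 => {}a in fr *.
have nu_tr : nu * (a + e) = 0.
  by have [x [y [v]]] := fr; exact: gl_frame_nu.
have [aE | a_neq_e] := eqVneq a e.
  subst e; have [a0 | a_neq0] := eqVneq a 0.
    subst a; have [nu0 | nu_neq0] := eqVneq nu 0.
      exists 0, 0, 0, c, 0; rewrite -row1_1E -[in has_gl_frame _]nu0.
      by split=> //; exact: row1_1.
    have := scaled_frame (invr_neq0 nu_neq0) fr; rewrite mulVf // mulr0 => fr1.
    exists 1, 0, 0, (nu^-1 * c), 0; rewrite -row1_4E.
    by split=> //; exact: row1_4.
  have := scaled_frame (invr_neq0 a_neq0) fr; rewrite mulVf // => fr1.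
  exists (a^-1 * nu), 1, 0, (a^-1 * c), 1.
  by rewrite -(row1_5E char2); split=> //; exact: row1_5.
have tr_neq0 : a + e != 0.
  by apply: contra_neq a_neq_e => /(eq_of_addv0 char2 (W := k^o)).
have nu0 : nu = 0.
  by move/eqP: nu_tr; rewrite mulf_eq0 (negPf tr_neq0) orbF => /eqP.
have := scaled_frame (invr_neq0 tr_neq0) (diagonal_frame a_neq_e fr).
have -> : (a + e)^-1 * e = (a + e)^-1 * a + 1.
  by rewrite -[1](mulVf tr_neq0); ring: (two0 char2).
rewrite nu0 !mulr0 => fr1.
exists 0, ((a + e)^-1 * a), 0, 0, ((a + e)^-1 * a + 1).
by rewrite -(row1_3E char2); split=> //; exact: row1_3.
Qed.
End Closed.

Theorem proposition4p16 (k : closedFieldType) (char2 : 2%N \in [pchar k]) :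
  (forall br : {bilinear twounit_P k -> twounit_P k -> twounit_P k},
     listed br ->
     exists lieP : is_ver4_lie br, in_class (Ver4Lie lieP))
  /\
  (forall g : ver4_lie k, in_class g ->
     exists (br : {bilinear twounit_P k -> twounit_P k -> twounit_P k})
            (lieP : is_ver4_lie br),
       listed br /\ ver4_lie_iso g (Ver4Lie lieP)).
Proof.
split=> [br /(listed_gl_bracket char2) [nu [a [b [c [e [-> nu_tr]]]]]] | g gP].
  by exists (gl_bracket_lie char2 b c nu_tr); exact: gl_bracket_in_class.
have objP := in_class_obj gP.
have f0 (v w : g) : ver4_d g w = 0 -> ver4_d g (ver4_br g v w) = 0.
  by move=> dw; apply/eqP; rewrite -memv_ker (in_class_f0 gP) // memv_ker dw.
have [x [y [v hfr]]] := in_class_heis_frame gP.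
have [nu [a [b [c [e [v1 fr]]]]]] := gl_frame_exists char2 f0 objP hfr.
have [|nu' [a' [b' [c' [e' [row [x2 [y2 [v2 fr2]]]]]]]]] :=
  @normal_form k char2 g f0 nu a b c e; first by exists x, y, v1.
have [lieP iso] := gl_frame_iso char2 f0 objP fr2.
by exists (gl_bracket nu' a' b' c' e'), lieP.
Qed.
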